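(* Let $\mathcal{A},\mathcal{B},\mathcal{C}$ be finite-dimensional complex Hilbert spaces with $\dim\mathcal{C}\geq\dim(\mathcal{A}\otimes\mathcal{B})$, let $\ket{\mathrm{idle}}\in\mathcal{B}$ be a unit vector, and let $L$ be a subunitary operator on $\mathcal{A}\otimes\mathcal{B}$ with $L(\ket{\varphi}\otimes\ket{\mathrm{idle}})=\ket{\varphi}\otimes\ket{\mathrm{idle}}$ for all $\ket{\varphi}\in\mathcal{A}$. Let $\ket{\xi}\neq0$ and $\ket{\tau}$ be vectors in $\mathcal{A}\otimes\mathcal{B}\otimes\mathcal{C}$, and let $\mathrm{Adv}(\ket{\xi}\to\ket{\tau})$ be the adversary bound defined in the context. Then: (1) Every algorithm that transforms $\ket{\xi}$ exactly into $\ket{\tau}$ uses at least $\mathrm{Adv}(\ket{\xi}\to\ket{\tau})$ timesteps. (2) Suppose $\mathrm{Adv}(\ket{\xi}\to\ket{\tau})<\infty$. For every $\varepsilon>0$ there is an algorithm with ancilla space $\mathcal{C}\otimes\mathbb{C}^2$ using $$T'=\left\lceil\frac{\mathrm{Adv}(\ket{\xi}\to\ket{\tau})}{\varepsilon^2}\right\rceil$$ timesteps that transforms $\ket{\xi}\otimes\ket{0}$ into $\ket{\tau'}\otimes\ket{0}+\ket{\Delta}\otimes\ket{1}$ for some $\ket{\tau'},\ket{\Delta}\in\mathcal{A}\otimes\mathcal{B}\otimes\mathcal{C}$ with $\|\ket{\tau'}-\ket{\tau}\|/\|\ket{\xi}\|\leq\varepsilon$, and whose intermediate states $\ket{\Phi^j}$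 satisfy $$\sum_{j=0}^{T'-1}\bra{\Phi^j}(I-P_{\mathrm{idle}})\ket{\Phi^j}\big/\langle\xi|\xi\rangle\leq\mathrm{Adv}(\ket{\xi}\to\ket{\tau}).$$
   Context: A $T$-timestep algorithm with ancilla space $\mathcal{C}'$ consists of unitaries $U_0,\dots,U_T$ on $\mathcal{B}\otimes\mathcal{C}'$ and applies $E=(I_{\mathcal{A}}\otimes U_T)(L\otimes I_{\mathcal{C}'})(I_{\mathcal{A}}\otimes U_{T-1})\cdots(L\otimes I_{\mathcal{C}'})(I_{\mathcal{A}}\otimes U_0)$ to an initial state $\ket{x}$ in $\mathcal{A}\otimes\mathcal{B}\otimes\mathcal{C}'$; it transforms $\ket{x}$ into $E\ket{x}$. Its intermediate states are $\ket{\Phi^j}=(I_{\mathcal{A}}\otimes U_j)(L\otimes I)\cdots(L\otimes I)(I_{\mathcal{A}}\otimes U_0)\ket{x}$ for $0\leq j\leq T-1$ (the state directly before the $(j+1)$-th application of $L$). $P_{\mathrm{idle}}=I_{\mathcal{A}}\otimes\ket{\mathrm{idle}}\bra{\mathrm{idle}}\otimes I_{\mathcal{C}'}$. Subunitary means $\|L\ket{\varphi}\|\leq\|\ket{\varphi}\|$ for all $\ket{\varphi}$. States need not be normalized; $\mathrm{tr}_{\mathcal{B}}$ etc. are partial traces. The adversary bound $\mathrm{Adv}(\ket{\xi}\to\ket{\tau})$ is the optimal (infimum) value of: minimize $\mathrm{tr}(\overline{\pi})/\langle\xi|\xi\rangle$ over positive semidefinite operators $\overline{\pi}$ on $\mathcal{A}\otimes\mathcal{B}$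 subject to $\mathrm{tr}_{\mathcal{B}}(L\overline{\pi}L^\dagger-\overline{\pi})=\mathrm{tr}_{\mathcal{B}\mathcal{C}}(\ket{\tau}\bra{\tau}-\ket{\xi}\bra{\xi})$ (value $+\infty$ if infeasible). *)

(* Defs.v *)
From HB Require Import structures.
From mathcomp Require Import all_boot all_order all_algebra.
From mathcomp Require Import complex.
From mathcomp Require Import mathcomp_extra boolp classical_sets reals ereal.

Set Implicit Arguments.
Unset Strict Implicit.
Unset Printing Implicit Defensive.

Import Order.TTheory GRing.Theory Num.Theory.
Local Open Scope ring_scope.

(* A finite-dimensional complex Hilbert space is modelled as functions from a
   finite index type (an orthonormal basis) to C = R[i]; operators are
   matrices indexed by that type.  Tensor products are product index types,
   with A⊗B⊗C' indexed by ((A*B)*C'). *)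

Section Defs.
Variable R : realType.
Local Notation C := (R[i]).

Definition vec (I : finType) := I -> C.
Definition op (I : finType) := I -> I -> C.

Definition ap (I : finType) (M : op I) (v : vec I) : vec I :=
  fun i => \sum_(j : I) M i j * v j.

Definition inner (I : finType) (u v : vec I) : C :=
  \sum_(i : I) conjc (u i) * v i.

Definition vnorm2 (I : finType) (v : vec I) : R :=
  \sum_(i : I) (complex.Re (v i) ^+ 2 + complex.Im (v i) ^+ 2).

Definition vnorm (I : finType) (v : vec I) : R := Num.sqrt (vnorm2 v).

Definition vsub (I : finType) (u v : vec I) : vec I := fun i => u i - v i.

Definition subunitary (I : finType) (M : op I) : Prop :=
  forall v : vec I, vnorm (ap M v) <= vnorm v.

(* unitary: U^dagger U = I (equivalent to U U^dagger = I in finite dimension) *)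
Definition unitary (I : finType) (U : op I) : Prop :=
  forall i j : I, \sum_(k : I) conjc (U k i) * U k j = (i == j)%:R.

(* positive semidefinite: <v|M v> >= 0 for all v (complex order: real and >= 0) *)
Definition psd (I : finType) (M : op I) : Prop :=
  forall v : vec I, 0 <= inner v (ap M v).

Definition trace (I : finType) (M : op I) : C := \sum_(i : I) M i i.

Definition tens (A B : finType) (phi : vec A) (w : vec B) : vec (prod A B) :=
  fun ab => phi ab.1 * w ab.2.

Definition apL (A B C' : finType) (L : op (prod A B)) (v : vec (prod (prod A B) C'))
  : vec (prod (prod A B) C') :=
  fun abc => \sum_(ab : prod A B) L abc.1 ab * v (ab, abc.2).

Definition apU (A B C' : finType) (U : op (prod B C')) (v : vec (prod (prod A B) C'))
  : vec (prod (prod A B) C') :=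
  fun abc => \sum_(bc : prod B C')
     U (abc.1.2, abc.2) bc * v ((abc.1.1, bc.1), bc.2).

(* Intermediate states of the algorithm (U_0, U_1, ...) on input x:
   Phi 0 = (I⊗U_0) x,  Phi (j+1) = (I⊗U_{j+1}) (L⊗I) (Phi j).
   Phi j (j <= T-1) is the state just before the (j+1)-th application of L,
   and Phi T = E x is the output of the T-timestep algorithm. *)
Fixpoint Phi (A B C' : finType) (L : op (prod A B)) (U : nat -> op (prod B C'))
  (x : vec (prod (prod A B) C')) (j : nat) : vec (prod (prod A B) C') :=
  match j with
  | 0 => apU (U 0%N) x
  | j'.+1 => apU (U j) (apL L (Phi L U x j'))
  end.

Definition run (A B C' : finType) (L : op (prod A B)) (U : nat -> op (prod B C'))
  (T : nat) (x : vec (prod (prod A B) C')) := Phi L U x T.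

Definition is_algorithm (B C' : finType) (U : nat -> op (prod B C')) (T : nat) :=
  forall j, (j <= T)%N -> unitary (U j).

Definition apPidle (A B C' : finType) (idle : vec B) (v : vec (prod (prod A B) C'))
  : vec (prod (prod A B) C') :=
  fun abc => idle abc.1.2 *
     \sum_(b : B) conjc (idle b) * v ((abc.1.1, b), abc.2).

Definition nonidle (A B C' : finType) (idle : vec B) (v : vec (prod (prod A B) C')) : R :=
  complex.Re (inner v (vsub v (apPidle idle v))).

Definition conj_op (I : finType) (L M : op I) : op I :=
  fun i j => \sum_(k : I) \sum_(l : I) L i k * M k l * conjc (L j l).

Definition ptrB (A B : finType) (M : op (prod A B)) : op A :=
  fun a a' => \sum_(b : B) M (a, b) (a', b).

Definition ptrBC_outer (A B Cc : finType) (u v : vec (prod (prod A B) Cc)) : op A :=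
  fun a a' => \sum_(b : B) \sum_(c : Cc) u ((a, b), c) * conjc (v ((a', b), c)).

Definition adv_feasible (A B Cc : finType) (L : op (prod A B))
  (xi tau : vec (prod (prod A B) Cc)) (pi : op (prod A B)) : Prop :=
  psd pi /\
  forall a a' : A,
    ptrB (conj_op L pi) a a' - ptrB pi a a'
    = ptrBC_outer tau tau a a' - ptrBC_outer xi xi a a'.

(* Adv(xi -> tau) = inf tr(pi)/<xi|xi> over feasible pi; +oo if infeasible *)
Definition Adv (A B Cc : finType) (L : op (prod A B))
  (xi tau : vec (prod (prod A B) Cc)) : \bar R :=
  ereal_inf [set ((complex.Re (trace pi)) / vnorm2 xi)%:E
            | pi in [set pi | adv_feasible L xi tau pi]].

(* xi ⊗ |0>, with C^2 indexed by bool and |0> = false *)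
Definition ext0 (A B Cc : finType) (xi : vec (prod (prod A B) Cc))
  : vec (prod (prod A B) (prod Cc bool)) :=
  fun i => if i.2.2 then 0 else xi (i.1, i.2.1).

End Defs.

(* Main.v *)
Require Import Defs.
From HB Require Import structures.
From mathcomp Require Import all_boot all_order all_algebra.
From mathcomp Require Import complex.
From mathcomp Require Import mathcomp_extra boolp classical_sets reals ereal.
From mathcomp Require Import topology normedtype derive.
From mathcomp Require Import ring lra.
From mathcomp Require spectral.
Import Order.TTheory GRing.Theory Num.Theory.
Import numFieldNormedType.Exports.
Local Open Scope ring_scope.

Set Implicit Arguments.
Unset Strict Implicit.
Unset Printing Implicit Defensive.

(* States are handled through reduced densities: two vectors of A⊗B⊗C' with the
   same reduced density on A are related by a unitary on B⊗C', and every
   positive semidefinite operator has a purification in a large enough space.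

   Lower bound: the sum of the reduced densities of the intermediate states on
   A⊗B is feasible, by telescoping, and its trace is at most T<xi|xi>.

   Algorithm: an optimal solution exists by compactness; let w purify it and put
   v = w/sqrt T.  Were the initial state xi|0> + v|1> available, the states
   c_k = psi_k|0> + v|1>, where psi_k is idle and purifies the interpolation
   (1-k/T) rho_xi + (k/T) rho_tau, would lead exactly to tau|0> + v|1>: applying
   L to c_k yields the reduced density of c_{k+1}.  The actual run starts from
   xi|0>, at distance |v| from the ideal state.  It is accompanied by a vector
   x_k that stays within |v| of c_k and whose reduced density on A is dominated
   by that of the actual state.  Before each application of L, the non-idle part
   of x_k is scaled down to norm at most |v|, which only brings x_k closer to
   c_k, and the actual state is chosen to have the density of x_k on A⊗B with
   all the remaining weight idle.  So each step has non-idle weight at most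
   |v|^2, and |v|^2 T <= tr pi. *)

(** * Inner products, and unitaries between families with equal Gram matrices *)

Section Inner.
Variables (R : realType).
Local Notation C := (R[i]).
Implicit Types (I J : finType).

Lemma conjc_sum J (P : pred J) (F : J -> C) :
  conjc (\sum_(j | P j) F j) = \sum_(j | P j) conjc (F j).
Proof. exact: raddf_sum. Qed.

Lemma mul_conjc (x : C) :
  x * conjc x = (complex.Re x ^+ 2 + complex.Im x ^+ 2)%:C%C.
Proof. by rewrite add_Re2_Im2 -normCK. Qed.

Lemma innerC I (u v : vec R I) : inner u v = conjc (inner v u).
Proof.
rewrite /inner conjc_sum; apply: eq_bigr => i _.
by rewrite rmorphM /= conjcK mulrC.
Qed.

Lemma inner_vnorm2 I (v : vec R I) : inner v v = (vnorm2 v)%:C%C.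
Proof.
rewrite /inner /vnorm2 rmorph_sum /=; apply: eq_bigr => i _.
by rewrite mulrC mul_conjc.
Qed.

Lemma vnorm2_ge0 I (v : vec R I) : 0 <= vnorm2 v.
Proof. by apply: sumr_ge0 => i _; rewrite addr_ge0 ?sqr_ge0. Qed.

Lemma vnorm2_eq0 I (v : vec R I) : vnorm2 v = 0 -> forall i, v i = 0.
Proof.
move=> /eqP; rewrite psumr_eq0; last by move=> i _; rewrite addr_ge0 ?sqr_ge0.
move=> /allP h i; have := h i (mem_index_enum i).
rewrite paddr_eq0 ?sqr_ge0 // !sqrf_eq0 => /andP[/eqP hr /eqP hi].
by rewrite [v i]complexE hr hi mulr0 addr0.
Qed.

Lemma innerBZl I (x y d : vec R I) (k : C) :
  inner (fun i => x i - d i * k) y = inner x y - conjc k * inner d y.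
Proof.
rewrite /inner mulr_sumr -sumrB; apply: eq_bigr => i _.
by rewrite rmorphB rmorphM /=; ring.
Qed.

Lemma innerBZr I (x y d : vec R I) (k : C) :
  inner x (fun i => y i - d i * k) = inner x y - k * inner x d.
Proof. by rewrite innerC innerBZl rmorphB rmorphM /= conjcK -!innerC. Qed.

Lemma innerBl I (x y z : vec R I) : inner (vsub x y) z = inner x z - inner y z.
Proof.
by rewrite /inner -sumrB; apply: eq_bigr => i _; rewrite rmorphB /= mulrBl.
Qed.

Lemma innerBr I (x y z : vec R I) : inner z (vsub x y) = inner z x - inner z y.
Proof. by rewrite /inner -sumrB; apply: eq_bigr => i _; rewrite mulrBr. Qed.

Definition isometric I (U : op R I) :=
  forall x y : vec R I, inner (ap U x) (ap U y) = inner x y.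

Definition delta I (i : I) : vec R I := fun j => (j == i)%:R.

Lemma ap_delta I (M : op R I) j : ap M (delta j) = M^~ j.
Proof.
apply: funext => i; rewrite /ap (bigD1 j) //= /delta eqxx mulr1 big1 ?addr0 //.
by move=> k /negbTE ->; rewrite mulr0.
Qed.

Lemma unitaryP I (U : op R I) : unitary U <-> isometric U.
Proof.
split=> [hU x y|hU i j]; last first.
  have := hU (delta i) (delta j); rewrite !ap_delta /inner => ->.
  rewrite (bigD1 i) //= /delta eqxx conjc1 mul1r big1 ?addr0 // => k /negbTE ->.
  by rewrite conjc0 mul0r.
rewrite /inner /ap.
under eq_bigr => k _ do rewrite conjc_sum big_distrlr /=.
rewrite exchange_big /=; apply: eq_bigr => i _.
have e j : \sum_k conjc (U k i * x i) * (U k j * y j)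
    = (i == j)%:R * (conjc (x i) * y j).
  rewrite -hU mulr_suml; apply: eq_bigr => k _; rewrite rmorphM /=; ring.
rewrite exchange_big /= (bigD1 i) //= e eqxx mul1r big1 ?addr0 // => j ji.
by rewrite e eq_sym (negbTE ji) mul0r.
Qed.

(* Take the unitary 1 - d d^* / <d,x> with d = x - y. *)
Lemma reflection I (x y : vec R I) : inner x x = inner y y ->
  exists H : op R I, [/\ unitary H, ap H x = y &
    forall z, inner x z = inner y z -> ap H z = z].
Proof.
move=> exy; set d := vsub x y; set s := inner d x.
pose H : op R I := fun i j => (i == j)%:R - d i * conjc (d j) / s.
have apH z : ap H z = fun i => z i - d i * (inner d z / s).
  apply: funext => i; rewrite /ap /H.
  under eq_bigr => j _ do rewrite mulrBl.
  rewrite sumrB (bigD1 i) //= eqxx mul1r big1 ?addr0 => [|j]; last first.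
    by rewrite eq_sym => /negbTE ->; rewrite mul0r.
  congr (_ - _); rewrite /inner mulr_suml mulr_sumr; apply: eq_bigr => j _; ring.
(* As [x] and [y] have equal norms, [<d,d>] is twice the real part of [s]; this is what makes [H]
   unitary. *)
have dd : inner d d = s + conjc s.
  rewrite /s -innerC /d !innerBl !innerBr exy; ring.
(* If [s = 0], this identity gives [d = 0], so [x = y] and [H] is the identity. *)
exists H; have [s0|s0] := eqVneq s 0.
  have d0 i : d i = 0.
    apply: vnorm2_eq0 i.
    by have := inner_vnorm2 d; rewrite dd s0 conjc0 addr0 => -[<-].
  have apHid z : ap H z = z.
    by rewrite apH; apply: funext => i; rewrite d0 mul0r subr0.
  split=> //; first by apply/unitaryP => u v; rewrite !apHid.
  rewrite apHid; apply: funext => i.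
  by apply/eqP; rewrite -subr_eq0; apply/eqP; exact: d0.
split.
- apply/unitaryP => u v; rewrite !apH innerBZl !innerBZr.
  rewrite dd [inner u d]innerC rmorphM /= fmorphV /=.
  have cs0 : conjc s != 0 by rewrite conjc_eq0.
  by field; rewrite s0 cs0.
- rewrite apH -/s divff //; apply: funext => i; rewrite mulr1 /d /vsub; ring.
- move=> z xz; rewrite apH /d innerBl xz subrr mul0r; apply: funext => i.
  by rewrite mulr0 subr0.
Qed.

(** Induction on a list of indices: a unitary matching the earlier pairs is followed by a reflection
    taking [ap U (u a)] to [v a]. Each earlier [v b] has equal inner products with these two
    vectors, so the reflection fixes it. *)
Lemma gram_unitary I (A : finType) (u v : A -> vec R I) :
  (forall a a', inner (u a) (u a') = inner (v a) (v a')) ->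
  exists U : op R I, unitary U /\ forall a, ap U (u a) = v a.
Proof.
move=> huv; suff [U [hU hs]] : exists U : op R I, isometric U /\
    forall a, a \in enum A -> ap U (u a) = v a.
  by exists U; split=> [|a]; [exact/unitaryP | apply: hs; rewrite mem_enum].
elim: (enum A) => [|a s [U [hU hs]]].
  exists (fun i j => (i == j)%:R); split=> // x y.
  have e z : ap (fun i j : I => (i == j)%:R) z = z :> vec R I.
    apply: funext => i; rewrite /ap (bigD1 i) //= eqxx mul1r big1 ?addr0 // => j.
    by rewrite eq_sym => /negbTE ->; rewrite mul0r.
  by rewrite !e.
have [|H [/unitaryP hH Ha Hs]] := @reflection _ (ap U (u a)) (v a).
  by rewrite hU huv.
exists (fun i j => \sum_k H i k * U k j).
have apHU z : ap (fun i j => \sum_k H i k * U k j) z = ap H (ap U z).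
  apply: funext => i; rewrite /ap.
  under eq_bigr => j _ do rewrite mulr_suml.
  rewrite exchange_big /=; apply: eq_bigr => k _.
  by rewrite mulr_sumr; apply: eq_bigr => j _; rewrite mulrA.
split=> [x y|b]; first by rewrite !apHU hH hU.
rewrite inE apHU => /orP[/eqP -> //|bs].
by rewrite hs // Hs // -(hs _ bs) hU huv hs.
Qed.

End Inner.

(** * Positive semidefinite operators and their purifications *)

Section Purification.
Variables (R : realType).
Local Notation C := (R[i]).
Implicit Types (I J G : finType).

(** With [u] read as an [I] by [G] matrix this is [u u^*], the reduced density after tracing out
    [G]. *)
Definition dens I G (u : vec R (prod I G)) : op R I :=
  fun i j => \sum_(g : G) u (i, g) * conjc (u (j, g)).

Lemma inner_delta I (i : I) (w : vec R I) : inner (delta R i) w = w i.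
Proof.
rewrite /inner (bigD1 i) //= /delta eqxx conjc1 mul1r big1 ?addr0 // => j.
by move=> /negbTE ->; rewrite conjc0 mul0r.
Qed.

(** Polarization: the quadratic form is real at [delta i - k delta j]; [k = 1] and [k = 'i] give the
    imaginary and the real part of the claim. *)
Lemma psd_hermitian I (M : op R I) : psd M -> forall i j, conjc (M j i) = M i j.
Proof.
move=> hM i j.
have q k : complex.Im (M i i - k * M i j - conjc k * (M j i - k * M j j)) = 0.
  have := hM (fun l => delta R i l - delta R j l * k).
  have -> : ap M (fun l => delta R i l - delta R j l * k)
      = fun l => M l i - M l j * k.
    apply: funext => l.
    have e j' : M l j' = ap M (delta R j') l by rewrite ap_delta.
    rewrite (e i) (e j) /ap.
    rewrite [X in _ = _ - X]mulr_suml -sumrB; apply: eq_bigr => m _.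
    by rewrite mulrBr mulrA.
  rewrite innerBZl !inner_delta => /ger0_Im <-; congr (complex.Im _); ring.
have := q 0; have := q 1; have := q 'i%C.
have qd l : complex.Im (M l l) = 0.
  by have := hM (delta R l); rewrite inner_delta ap_delta => /ger0_Im.
move: (qd i) (qd j).
case: (M i i) (M i j) (M j i) (M j j) => [a a'] [b b'] [c c'] [d d'] /= -> ->.
by simpc => /= h1 h2 _; apply/eqP; rewrite eq_complex /=; apply/andP; split;
  apply/eqP; lra.
Qed.

Lemma gram_psd I J (f : I -> J -> C) (M : op R I) :
  (forall i j, M i j = \sum_k f i k * conjc (f j k)) -> psd M.
Proof.
move=> hM v.
have -> : inner v (ap M v) =
    \sum_k (\sum_i conjc (v i) * f i k) * conjc (\sum_i conjc (v i) * f i k).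
  rewrite /inner /ap.
  under [RHS]eq_bigr => k _ do rewrite conjc_sum big_distrlr /=.
  rewrite exchange_big /=; apply: eq_bigr => i _.
  rewrite exchange_big /= mulr_sumr; apply: eq_bigr => j _.
  rewrite hM mulr_suml mulr_sumr; apply: eq_bigr => k _.
  by rewrite rmorphM /= conjcK; ring.
by apply: sumr_ge0 => k _; rewrite mul_conjc lecR addr_ge0 ?sqr_ge0.
Qed.

Lemma dens_psd I G (u : vec R (prod I G)) : psd (dens u).
Proof. by apply: (@gram_psd _ _ (fun i g => u (i, g))). Qed.

Lemma psdD I (M N : op R I) : psd M -> psd N -> psd (fun i j => M i j + N i j).
Proof.
move=> hM hN v.
have -> : inner v (ap (fun i j => M i j + N i j) v)
    = inner v (ap M v) + inner v (ap N v).
  rewrite /inner -big_split; apply: eq_bigr => i _ /=.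
  rewrite -mulrDr -big_split; congr (_ * _); apply: eq_bigr => j _ /=.
  by rewrite mulrDl.
by rewrite addr_ge0.
Qed.

Lemma psdZ I (M : op R I) (k : R) : 0 <= k -> psd M ->
  psd (fun i j => k%:C%C * M i j).
Proof.
move=> k0 hM v.
have -> : inner v (ap (fun i j => k%:C%C * M i j) v) = k%:C%C * inner v (ap M v).
  rewrite /inner mulr_sumr; apply: eq_bigr => i _ /=.
  rewrite /ap !mulr_sumr; apply: eq_bigr => j _; ring.
by rewrite mulr_ge0 // lecR.
Qed.

Lemma sum_pick_inj I G (h : I -> G) (F : I -> C) : injective h ->
  \sum_g (if [pick k | h k == g] is Some k then F k else 0) = \sum_k F k.
Proof.
move=> hi; rewrite (bigID (mem (codom h))) /= [X in _ + X]big1 ?addr0.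
  rewrite -big_uniq /=; last by rewrite map_inj_uniq // enum_uniq.
  rewrite /codom big_image /=.
  apply: eq_bigr => k _; case: pickP => [l /eqP/hi -> //|/(_ k)].
  by rewrite eqxx.
move=> g gh; case: pickP => // k /eqP hk.
by move: gh; rewrite -hk codom_f.
Qed.

(** Spectral theorem: if [A = P^* D P] with [D >= 0], then [P^* sqrt D] times its adjoint is [A].
    Its columns are placed in [G] along an injection, with zeros elsewhere. *)
Lemma purify I G (M : op R I) : psd M -> (#|I| <= #|G|)%N ->
  exists u : vec R (prod I G), dens u = M.
Proof.
move=> hM leIG; pose n := #|I|.
pose A : 'M[C]_n := \matrix_(i, j) M (enum_val i) (enum_val j).
have /spectral.orthomx_spectralP : A \is spectral.normalmx.
  apply/spectral.normalmxP/matrixP => i j; rewrite !mxE; apply: eq_bigr => k _.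
  rewrite !mxE; congr (_ * _).
    by rewrite -[RHS]/(conjc _) psd_hermitian.
  by rewrite -[LHS]/(conjc _) psd_hermitian.
have := spectral.spectral_unitarymx A.
set P := spectral.spectralmx A; set D := spectral.spectral_diag A => uP.
rewrite spectral.invmx_unitary // => eA.
have eD : diag_mx D = P *m A *m (P^T ^ Num.conj)%sesqui.
  rewrite [in RHS]eA !mulmxA; move/spectral.unitarymxP: (uP) => ->.
  by rewrite mul1mx -mulmxA; move/spectral.unitarymxP: uP => ->; rewrite mulmx1.
(* Each eigenvalue is the quadratic form at the conjugate of a row of [P]. *)
have D0 k : 0 <= D 0 k.
  have := hM (fun i => conjc (P k (enum_rank i))).
  suff -> : inner (fun i => conjc (P k (enum_rank i)))
      (ap M (fun i => conjc (P k (enum_rank i)))) = D 0 k by [].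
  have := congr1 (fun X : 'M_n => X k k) eD; rewrite !mxE eqxx mulr1n => ->.
  rewrite /inner (reindex (@enum_val I I)) /=; last first.
    by exists enum_rank => i _; rewrite ?enum_rankK ?enum_valK.
  under eq_bigr => j _ do rewrite /ap mulr_sumr.
  rewrite exchange_big /= (reindex (@enum_val I I)) /=; last first.
    by exists enum_rank => i _; rewrite ?enum_rankK ?enum_valK.
  apply: eq_bigr => j _; rewrite !mxE mulr_suml; apply: eq_bigr => i _.
  by rewrite !mxE !enum_valK conjcK /= mulrA.
pose f i k : C := conjc (P k (enum_rank i)) * sqrtC (D 0 k).
have leI : (n <= #|G|)%N by [].
pose h (k : 'I_n) : G := enum_val (widen_ord leI k).
have hi : injective h by move=> k l /enum_val_inj [] /val_inj.
exists (fun ig => if [pick k | h k == ig.2] is Some k then f ig.1 k else 0).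
apply: funext => i; apply: funext => j; rewrite /dens /=.
rewrite -[i in RHS]enum_rankK -[j in RHS]enum_rankK.
have := congr1 (fun X : 'M_n => X (enum_rank i) (enum_rank j)) eA.
rewrite [in LHS]mxE => ->.
transitivity (\sum_k f i k * conjc (f j k)).
  rewrite -(sum_pick_inj _ hi); apply: eq_bigr => g _.
  by case: pickP => // _; rewrite mul0r.
rewrite mxE; apply: eq_bigr => k _.
rewrite mul_mx_diag !mxE /f rmorphM /= conjcK.
have -> : conjc (sqrtC (D 0 k)) = sqrtC (D 0 k).
  by apply: (@geC0_conj _ (sqrtC (D 0 k))); rewrite sqrtC_ge0.
move: (sqrtC _) (sqrtCK (D 0 k)) => t; rewrite expr2 => <-.
rewrite -[X in _ = X * _ * _]/(conjc _); ring.
Qed.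
End Purification.

(** * Reduced densities of states under [L] and under unitaries *)

Definition opadd (R : realType) (I : finType) (M N : op R I) : op R I :=
  fun i j => M i j + N i j.

Section States.
Variables (R : realType) (A B : finType).
Local Notation C := (R[i]).
Implicit Types (G : finType) (L : op R (prod A B)) (M N : op R (prod A B)).

(** The grouping [A ⊗ (B ⊗ G)]: a unitary on [B ⊗ G] acts on each slice separately, and [red u] is
    the Gram matrix of the slices up to transposition. *)
Definition slice G (u : vec R (prod (prod A B) G)) (a : A) : vec R (prod B G) :=
  fun bg => u ((a, bg.1), bg.2).

(** Unfolds to [ptrBC_outer u u], the form used in the feasibility constraint. *)
Definition red G (u : vec R (prod (prod A B) G)) : op R A := ptrB (dens u).

Lemma sum_triple G (F : A * B * G -> C) :
  \sum_i F i = \sum_a \sum_b \sum_g F ((a, b), g).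
Proof. by rewrite !pair_big /=; apply: eq_bigr => -[[]]. Qed.

Lemma red_inner G (u : vec R (prod (prod A B) G)) a a' :
  red u a a' = inner (slice u a') (slice u a).
Proof.
rewrite /red /ptrB /dens pair_big /=; apply: eq_bigr => bg _.
by rewrite mulrC.
Qed.

Lemma red_psd G (u : vec R (prod (prod A B) G)) : psd (red u).
Proof.
apply: (@gram_psd R A (prod B G) (fun a bg => slice u a bg)) => a a'.
by rewrite red_inner /inner; apply: eq_bigr => bg _; rewrite mulrC.
Qed.

Lemma inner_slice G (u v : vec R (prod (prod A B) G)) :
  inner u v = \sum_a inner (slice u a) (slice v a).
Proof.
rewrite /inner pair_big /=.
rewrite (reindex (fun p : A * (B * G) => ((p.1, p.2.1), p.2.2))) //=.
by exists (fun p => (p.1.1, (p.1.2, p.2))) => [[a [b g]]|[[a b] g]].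
Qed.

Lemma sum_red G (u : vec R (prod (prod A B) G)) :
  (vnorm2 u)%:C%C = \sum_a red u a a.
Proof.
by rewrite -inner_vnorm2 inner_slice; apply: eq_bigr => a _; rewrite red_inner.
Qed.

Lemma slice_apU G (U : op R (prod B G)) (u : vec R (prod (prod A B) G)) a :
  slice (apU U u) a = ap U (slice u a).
Proof. by apply: funext => -[]. Qed.

Lemma red_unitary G (U : op R (prod B G)) (u : vec R (prod (prod A B) G)) :
  unitary U -> red (apU U u) = red u.
Proof.
move=> /unitaryP hU; apply: funext => a; apply: funext => a'.
by rewrite !red_inner !slice_apU hU.
Qed.

Lemma vnorm2_unitary G (U : op R (prod B G)) (u : vec R (prod (prod A B) G)) :
  unitary U -> vnorm2 (apU U u) = vnorm2 u.
Proof.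
by move=> hU; apply: complexI; rewrite !sum_red red_unitary.
Qed.

(** The slices of [u] and [v] have equal Gram matrices, so a single unitary maps the former to the
    latter. *)
Lemma red_eq_unitary G (u v : vec R (prod (prod A B) G)) :
  red u = red v -> exists U : op R (prod B G), unitary U /\ apU U u = v.
Proof.
move=> huv; have [a a'|U [hU hv]] := @gram_unitary _ _ _ (slice u) (slice v).
  by rewrite -!red_inner huv.
exists U; split=> //; apply: funext => -[[a b] g].
by have := congr1 (fun f => f (b, g)) (hv a).
Qed.

Lemma apU_sub G (U : op R (prod B G)) (u v : vec R (prod (prod A B) G)) :
  apU U (vsub u v) = vsub (apU U u) (apU U v).
Proof.
apply: funext => i; rewrite /apU /vsub -sumrB; apply: eq_bigr => j _.
by rewrite mulrBr.
Qed.

Lemma apL_sub G L (u v : vec R (prod (prod A B) G)) :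
  apL L (vsub u v) = vsub (apL L u) (apL L v).
Proof.
apply: funext => i; rewrite /apL /vsub -sumrB; apply: eq_bigr => j _.
by rewrite mulrBr.
Qed.

Lemma dens_apL G L (u : vec R (prod (prod A B) G)) :
  dens (apL L u) = conj_op L (dens u).
Proof.
apply: funext => i; apply: funext => j; rewrite /dens /apL /conj_op /=.
under eq_bigr => g _ do rewrite conjc_sum big_distrlr /=.
rewrite exchange_big /=; apply: eq_bigr => k _.
rewrite exchange_big /=; apply: eq_bigr => l _.
rewrite mulr_sumr mulr_suml; apply: eq_bigr => g _.
by rewrite rmorphM /=; ring.
Qed.

Lemma vnorm2_apL G L (u : vec R (prod (prod A B) G)) :
  subunitary L -> vnorm2 (apL L u) <= vnorm2 u.
Proof.
move=> hL; rewrite /vnorm2.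
have e (w : vec R (prod (prod A B) G)) :
  \sum_i (complex.Re (w i) ^+ 2 + complex.Im (w i) ^+ 2) =
  \sum_g vnorm2 (fun ab => w (ab, g)).
  rewrite /vnorm2 exchange_big pair_big /=.
  by apply: eq_bigr => -[].
rewrite !e; apply: ler_sum => g _.
have := hL (fun ab => u (ab, g)).
by rewrite /vnorm ler_sqrt ?vnorm2_ge0.
Qed.

Lemma conj_opD L M N :
  conj_op L (opadd M N) = opadd (conj_op L M) (conj_op L N).
Proof.
apply: funext => i; apply: funext => j; rewrite /conj_op /opadd -big_split /=.
apply: eq_bigr => k _; rewrite -big_split /=; apply: eq_bigr => l _; ring.
Qed.

Lemma ptrBD M N : ptrB (opadd M N) = opadd (ptrB M) (ptrB N).
Proof. by apply: funext => i; apply: funext => j; rewrite /opadd /ptrB -big_split. Qed.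

Lemma trace_ptrB M : \sum_a ptrB M a a = trace M.
Proof. by rewrite /ptrB /trace pair_big /=; apply: eq_bigr => -[]. Qed.

(** The non-idle weight depends on a state only through its density on [A ⊗ B], and additively; any
    purification gives the same value. *)
Definition nonidle_op (idle : vec R B) M : R :=
  complex.Re (\sum_a \sum_b (M (a, b) (a, b) -
    idle b * \sum_b' conjc (idle b') * M (a, b') (a, b))).

Lemma nonidle_dens G idle (u : vec R (prod (prod A B) G)) :
  nonidle idle u = nonidle_op idle (dens u).
Proof.
rewrite /nonidle /nonidle_op /inner; congr (complex.Re _).
rewrite sum_triple; apply: eq_bigr => a _; apply: eq_bigr => b _.
rewrite /dens.
under [X in _ - _ * X]eq_bigr => b' _ do rewrite mulr_sumr.
rewrite exchange_big /= mulr_sumr -sumrB; apply: eq_bigr => g _.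
rewrite /vsub /apPidle /= mulrBr mulrC; congr (_ - _).
by rewrite !mulr_sumr; apply: eq_bigr => b' _; ring.
Qed.

Lemma nonidle_opD idle M N :
  nonidle_op idle (opadd M N) = nonidle_op idle M + nonidle_op idle N.
Proof.
rewrite /nonidle_op -raddfD -big_split /=; congr (complex.Re _).
apply: eq_bigr => a _; rewrite -big_split /=; apply: eq_bigr => b _.
rewrite /opadd; under eq_bigr do rewrite mulrDr.
by rewrite big_split /=; ring.
Qed.

End States.

(** * The idle projection and the reduction of non-idle weight *)

Section Truncation.
Variables (R : realType) (A B G : finType) (idle : vec R B).
Hypothesis idle1 : vnorm2 idle = 1.
Local Notation C := (R[i]).
Implicit Types (x c : vec R (prod (prod A B) G)).

Definition perp x : vec R (prod (prod A B) G) := vsub x (apPidle idle x).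

(** The idle projection acts inside each slice and is self-adjoint there. The slicewise form is
    needed because [red] consists of inner products of slices. *)
Lemma inner_slice_Pidle x c a a' :
  inner (slice x a) (slice (apPidle idle c) a')
  = inner (slice (apPidle idle x) a) (slice c a').
Proof.
have sum2 (F : B * G -> C) : \sum_i F i = \sum_g \sum_b F (b, g).
  by rewrite exchange_big pair_big; apply: eq_bigr => -[].
rewrite /inner !sum2; apply: eq_bigr => g _; rewrite /slice /apPidle /=.
transitivity ((\sum_b conjc (x ((a, b), g)) * idle b) *
              \sum_b conjc (idle b) * c ((a', b), g)).
  by rewrite mulr_suml; apply: eq_bigr => b _; rewrite mulrA.
rewrite mulr_sumr; apply: eq_bigr => b _.
rewrite [in RHS]rmorphM /= conjc_sum /=.
rewrite mulrCA -mulrA; congr (_ * (_ * _)).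
by apply: eq_bigr => b' _; rewrite rmorphM /= conjcK mulrC.
Qed.

Lemma apPidleK x : apPidle idle (apPidle idle x) = apPidle idle x.
Proof.
apply: funext => -[[a b] g]; rewrite /apPidle /=; congr (_ * _).
under eq_bigr do rewrite mulrA.
rewrite -mulr_suml [X in X * _](_ : _ = inner idle idle) //.
by rewrite inner_vnorm2 idle1 mul1r.
Qed.

Lemma inner_slice_perp x c a a' :
  inner (slice x a) (slice (perp c) a')
  = inner (slice (perp x) a) (slice (perp c) a').
Proof.
have sliceB u v b : slice (vsub u v) b = vsub (slice u b) (slice v b) by [].
rewrite /perp !sliceB !(innerBl, innerBr) !inner_slice_Pidle apPidleK subrr.
by rewrite subr0.
Qed.

Lemma inner_perp x c : inner x (perp c) = inner (perp x) (perp c).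
Proof. by rewrite !inner_slice; apply: eq_bigr => a _; rewrite inner_slice_perp. Qed.

Lemma nonidleE x : nonidle idle x = vnorm2 (perp x).
Proof. by rewrite /nonidle -/(perp x) inner_perp inner_vnorm2. Qed.

Lemma nonidle_le x : nonidle idle x <= vnorm2 x.
Proof.
rewrite -subr_ge0; suff -> : vnorm2 x - nonidle idle x = vnorm2 (vsub x (perp x)).
  exact: vnorm2_ge0.
apply: complexI; rewrite -inner_vnorm2 innerBl.
rewrite (innerBr _ _ x) (innerBr _ _ (perp x)) [inner (perp x) x]innerC.
rewrite (inner_perp x x) !inner_vnorm2 conjc_real nonidleE rmorphB /=; ring.
Qed.

Definition shrink (k : R) x : vec R (prod (prod A B) G) :=
  fun i => x i - perp x i * k%:C%C.

Lemma perp_shrink k x : perp (shrink k x) = fun i => perp x i * (1 - k)%:C%C.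
Proof.
have hD y z (s : C) : perp (fun i => y i - z i * s) = fun i => perp y i - perp z i * s.
  apply: funext => i; rewrite /perp /vsub /apPidle.
  under eq_bigr do rewrite mulrBr mulrA.
  by rewrite sumrB -mulr_suml; ring.
rewrite /shrink hD; have -> : perp (perp x) = perp x.
  have eP : perp x = fun i => x i - apPidle idle x i * 1.
    by apply: funext => i; rewrite mulr1.
  rewrite {1}eP hD; apply: funext => i.
  by rewrite /perp /vsub apPidleK subrr mul0r subr0.
by apply: funext => i; rewrite rmorphB /=; ring.
Qed.

(** Idle and non-idle parts are orthogonal slice by slice, and the latter is scaled by [1 - k]; the
    lost fraction is [1 - (1 - k)^2]. *)
Lemma red_shrink k x a a' :
  red x a a' = red (shrink k x) a a' + (2 * k - k ^+ 2)%:C%C * red (perp x) a a'.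
Proof.
rewrite !red_inner.
have sl b : slice (shrink k x) b = fun i => slice x b i - slice (perp x) b i * k%:C%C.
  by [].
rewrite !sl innerBZl !innerBZr (inner_slice_perp x x).
rewrite [inner (slice (perp x) a') (slice x a)]innerC (inner_slice_perp x x).
rewrite -innerC conjc_real rmorphB rmorphM rmorphXn /= rmorph_nat; ring.
Qed.

Lemma nonidle_shrink k x : nonidle idle (shrink k x) = (1 - k) ^+ 2 * nonidle idle x.
Proof.
rewrite !nonidleE perp_shrink /vnorm2 mulr_sumr; apply: eq_bigr => i _.
by case: (perp x i) => r s /=; ring.
Qed.

(* The part of x orthogonal to the idle subspace is projected radially onto a
   ball that contains the corresponding part of c. *)
Lemma truncate x c : exists z (Y : op R A),
  [/\ psd Y, red x = opadd (red z) Y, nonidle idle z <= nonidle idle c &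
      vnorm2 (vsub z c) <= vnorm2 (vsub x c)].
Proof.
set n := nonidle idle x; set m := nonidle idle c.
pose r := complex.Re (inner c (perp x)).
have dist y z (k : R) : vnorm2 (fun i => y i - z i * k%:C%C) =
    vnorm2 y - 2 * k * complex.Re (inner y z) + k ^+ 2 * vnorm2 z.
  apply: complexI; rewrite -inner_vnorm2 innerBZl !innerBZr !inner_vnorm2.
  rewrite conjc_real [inner z y]innerC.
  case: (inner y z) => a b /=; apply/eqP; rewrite eq_complex /=.
  by apply/andP; split; apply/eqP; simpc => /=; ring.
(* The right-hand side is the squared norm of [perp c - k perp x]. *)
have mr k : 0 <= m - 2 * k * r + k ^+ 2 * n.
  rewrite /m /n /r !nonidleE inner_perp -dist; exact: vnorm2_ge0.
have n0 : 0 <= n by rewrite /n nonidleE vnorm2_ge0.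
(* [hd] says that the distance to [c] does not grow. The factor [1 - k] is [r / n], the coefficient
   of [perp c] along [perp x], clamped to the interval from 0 to 1. *)
have [k [k0 k1 hm hd]] : exists k : R, [/\ 0 <= k, k <= 1, (1 - k) ^+ 2 * n <= m &
    k ^+ 2 * n <= 2 * k * (n - r)].
  have [rn|rn] := lerP n r.
    by exists 0; split=> //; have := mr 1; nra.
  have [r0|r0] := lerP r 0.
    by exists 1; split=> //; have := mr 0; nra.
  have np : 0 < n by exact: lt_trans rn.
  have := mr (r / n); have e : r / n * n = r by rewrite divfK // gt_eqF.
  set t := r / n in e *.
  have t0 : 0 < t by rewrite divr_gt0.
  have t1 : t <= 1 by rewrite ler_pdivrMr // mul1r ltW.
  by exists (1 - t); split; nra.
exists (shrink k x), (fun a a' => (2 * k - k ^+ 2)%:C%C * red (perp x) a a').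
split.
- by apply: psdZ; [nra | exact: red_psd].
- by apply: funext => a; apply: funext => a'; exact: red_shrink.
- by rewrite nonidle_shrink.
- have -> : vsub (shrink k x) c = fun i => vsub x c i - perp x i * k%:C%C.
    by apply: funext => i; rewrite /vsub /shrink; ring.
  rewrite dist innerBl [inner x _]inner_perp inner_vnorm2 -nonidleE.
  rewrite raddfB /= -/r -/n; nra.
Qed.

End Truncation.

(** * Simulation of the ideal run without the auxiliary [v ⊗ |1>] *)

Section Simulation.
Variables (R : realType) (A B Cc : finType) (idle : vec R B).
Variable L : op R (prod A B).
Hypothesis idle1 : vnorm2 idle = 1.
Hypothesis subL : subunitary L.
Hypothesis L_idle : forall phi : vec R A, ap L (tens phi idle) = tens phi idle.
Hypothesis card_le : (#|A| * #|B| <= #|Cc|)%N.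
Local Notation C := (R[i]).
Local Notation state := (vec R (prod (prod A B) Cc)).
Local Notation xstate := (vec R (prod (prod A B) (prod Cc bool))).

Definition join (u0 u1 : state) : xstate :=
  fun i => if i.2.2 then u1 (i.1, i.2.1) else u0 (i.1, i.2.1).

Definition part (f : bool) (x : xstate) : state := fun i => x (i.1, (i.2, f)).

Lemma join_part x : join (part false x) (part true x) = x.
Proof. by apply: funext => -[ab [c []]]. Qed.

Lemma sum_flag (F : Cc * bool -> C) :
  \sum_g F g = \sum_c F (c, false) + \sum_c F (c, true).
Proof.
transitivity (\sum_c \sum_f F (c, f)).
  by rewrite pair_big; apply: eq_bigr => -[].
by rewrite -big_split /=; apply: eq_bigr => c _; rewrite big_bool addrC.
Qed.

Lemma dens_join u0 u1 : dens (join u0 u1) = opadd (dens u0) (dens u1).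
Proof. by apply: funext => i; apply: funext => j; rewrite /dens sum_flag. Qed.

Lemma red_join u0 u1 : red (join u0 u1) = opadd (red u0) (red u1).
Proof. by rewrite /red dens_join ptrBD. Qed.

Lemma vnorm2_join u0 u1 : vnorm2 (join u0 u1) = vnorm2 u0 + vnorm2 u1.
Proof.
apply: complexI; rewrite rmorphD /= !sum_red red_join -big_split.
by apply: eq_bigr.
Qed.

Lemma apL_join u0 u1 : apL L (join u0 u1) = join (apL L u0) (apL L u1).
Proof. by apply: funext => -[ab [c []]]. Qed.

Lemma vsub_join u0 u1 w0 w1 :
  vsub (join u0 u1) (join w0 w1) = join (vsub u0 w0) (vsub u1 w1).
Proof. by apply: funext => -[ab [c []]]. Qed.

(** [L] leaves such a state unchanged, so it carries a density on [A] at no non-idle cost. *)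
Definition idle_state (G : finType) (p : vec R (prod A G)) :
  vec R (prod (prod A B) G) := fun i => p (i.1.1, i.2) * idle i.1.2.

Lemma red_idle_state (G : finType) (p : vec R (prod A G)) : red (idle_state p) = dens p.
Proof.
apply: funext => a; apply: funext => a'; rewrite /red /ptrB /dens /idle_state /=.
rewrite exchange_big /=; apply: eq_bigr => g _.
transitivity (p (a, g) * conjc (p (a', g)) * inner idle idle); last first.
  by rewrite inner_vnorm2 idle1 mulr1.
by rewrite mulr_sumr; apply: eq_bigr => b _; rewrite rmorphM /=; ring.
Qed.

Lemma nonidle_idle_state (G : finType) (p : vec R (prod A G)) :
  nonidle idle (idle_state p) = 0.
Proof.
rewrite (nonidleE idle1) /vnorm2 big1 // => -[[a b] g] _.
suff -> : perp idle (idle_state p) (a, b, g) = 0 by rewrite expr0n addr0.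
rewrite /perp /vsub /apPidle /idle_state /=.
under eq_bigr do rewrite mulrCA.
rewrite -mulr_sumr -/(inner idle idle) inner_vnorm2 idle1; ring.
Qed.

Lemma apL_idle_state (G : finType) (p : vec R (prod A G)) :
  apL L (idle_state p) = idle_state p.
Proof.
apply: funext => -[ab g].
exact: (congr1 (fun f => f ab) (L_idle (fun a => p (a, g)))).
Qed.

Lemma Phi_ext (G : finType) (U U' : nat -> op R (prod B G)) x k :
  (forall j, (j <= k)%N -> U j = U' j) -> Phi L U x k = Phi L U' x k.
Proof.
elim: k => [|k IH] h /=; first by rewrite h.
by rewrite h // IH // => j jk; apply: h; exact: leqW.
Qed.

Variables (xi tau v : state) (T : nat).
(** What one application of [L] to [v] adds to the density on [A]; by [gainE], [T] of them lead from
    [xi] to [tau]. *)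
Definition gain : op R A := fun a a' => red (apL L v) a a' - red v a a'.
Hypothesis gainE :
  forall a a', T%:R * gain a a' = red tau a a' - red xi a a'.

(** The vector that [U k] receives; it does not depend on [U k], which can thus be chosen
    afterwards. *)
Definition before (U : nat -> op R (prod B (prod Cc bool))) k : xstate :=
  if k is j.+1 then apL L (Phi L U (ext0 xi) j) else ext0 xi.

Lemma PhiE U k : Phi L U (ext0 xi) k = apU (U k) (before U k).
Proof. by case: k. Qed.

Lemma card_idle : (0 < #|B|)%N.
Proof.
rewrite lt0n; apply/negP => /eqP /card0_eq B0.
move: idle1; rewrite /vnorm2 big_pred0 => [/eqP|b]; last exact: B0.
by rewrite eq_sym oner_eq0.
Qed.

(** By [gainE] this operator is a convex combination of the densities of [xi] and [tau], hence
    positive semidefinite; [k < T] makes [T] nonzero. *)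
Lemma ideal_state k : (k < T)%N -> exists p : vec R (prod A Cc),
  dens p = fun a a' => red xi a a' + k%:R * gain a a'.
Proof.
move=> kT; apply: purify; last first.
  by apply: leq_trans card_le; rewrite leq_pmulr // card_idle.
have T0 : (0 < T)%N by apply: leq_ltn_trans kT.
suff -> : (fun a a' => red xi a a' + k%:R * gain a a') = (fun a a' =>
    (1 - k%:R / T%:R : R)%:C%C * red xi a a' + (k%:R / T%:R : R)%:C%C * red tau a a').
  have t1 : (k%:R / T%:R : R) <= 1.
    rewrite ler_pdivrMr; last by rewrite ltr0n.
    by rewrite mul1r ler_nat ltnW.
  apply: psdD; apply: psdZ; rewrite ?subr_ge0 ?divr_ge0 //; exact: red_psd.
apply: funext => a; apply: funext => a'.
have -> : red tau a a' = red xi a a' + T%:R * gain a a' by rewrite gainE; ring.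
have TC0 : (T%:R : C) != 0 by rewrite pnatr_eq0 -lt0n.
rewrite rmorphB /= fmorph_div /= !rmorph_nat; field.
exact: TC0.
Qed.

(* [e] is the ideal state before the k-th step and [x] the tracking vector. *)
Lemma simulation_step k U (x e : xstate) (Y : op R A) :
  (k < T)%N -> psd Y -> red (before U k) = opadd (red x) Y ->
  red e = opadd (fun a a' => red xi a a' + k%:R * gain a a') (red v) ->
  vnorm2 (vsub x e) <= vnorm2 v ->
  exists Uk (x' e' : xstate) (Y' : op R A), [/\ unitary Uk,
    nonidle idle (apU Uk (before U k)) <= vnorm2 v,
    psd Y' /\ red (apL L (apU Uk (before U k))) = opadd (red x') Y',
    red e' = opadd (fun a a' => red xi a a' + k.+1%:R * gain a a') (red v) &
    vnorm2 (vsub x' e') <= vnorm2 v :> R].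
Proof.
move=> kT Yp redU rede dist.
have [p dp] := ideal_state kT.
pose c := join (idle_state p) v.
have [V [uV Ve]] : exists V, unitary V /\ apU V e = c.
  by apply: red_eq_unitary; rewrite rede red_join red_idle_state dp.
have [z [Y1 [Y1p redx nz dz]]] := truncate idle1 (apU V x) c.
have distV : vnorm2 (vsub (apU V x) c) <= vnorm2 v.
  by rewrite -Ve -apU_sub vnorm2_unitary.
have nc : nonidle idle c <= vnorm2 v.
  rewrite nonidle_dens dens_join nonidle_opD -!nonidle_dens.
  by rewrite nonidle_idle_state add0r nonidle_le.
(* The density lost in the truncation joins the earlier deficit [Y]. *)
have [y dy] : exists y : vec R (prod A A), dens y = opadd Y1 Y.
  by apply: purify; [exact: psdD|].
(* The state to be fed to [L]: the density of [z], plus the whole deficit in idle form. *)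
have [w dw] : exists w : xstate, dens w = opadd (dens z) (dens (idle_state y)).
  apply: purify; first by apply: psdD; exact: dens_psd.
  by rewrite !card_prod card_bool (leq_trans card_le) // leq_pmulr.
have redw : red (before U k) = red w.
  rewrite [in RHS]/red dw ptrBD -!/(red _) red_idle_state dy redU.
  rewrite -(red_unitary x uV) redx; apply: funext => a; apply: funext => a'.
  by rewrite /opadd addrA.
have [Uk [uUk Uw]] := red_eq_unitary redw.
exists Uk, (apL L z), (apL L c), (opadd Y1 Y); split=> //.
- rewrite Uw nonidle_dens dw nonidle_opD -!nonidle_dens nonidle_idle_state.
  by rewrite addr0 (le_trans nz).
(* [L] fixes the idle summand, so the deficit is carried over unchanged. *)
- split; first exact: psdD.
  rewrite Uw /red dens_apL dw conj_opD ptrBD -!dens_apL -!/(red _).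
  by rewrite apL_idle_state red_idle_state dy.
(* [L] fixes the idle part of [c] and adds one [gain] through [v]. *)
- rewrite apL_join red_join apL_idle_state red_idle_state dp.
  apply: funext => a; apply: funext => a'.
  rewrite /opadd [in RHS]mulrSr /gain; ring.
- rewrite -apL_sub; apply: le_trans (vnorm2_apL _ subL) _.
  exact: le_trans dz distV.
Qed.

(** The unitaries are fixed one at a time; redefining [U] at [k] affects neither [before U k] nor
    the earlier states. *)
Lemma simulation_prefix k : (k <= T)%N -> exists U (x e : xstate) (Y : op R A),
  [/\ forall j, unitary (U j),
    forall j, (j < k)%N -> nonidle idle (Phi L U (ext0 xi) j) <= vnorm2 v,
    psd Y /\ red (before U k) = opadd (red x) Y,
    red e = opadd (fun a a' => red xi a a' + k%:R * gain a a') (red v) &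
    vnorm2 (vsub x e) <= vnorm2 v :> R].
Proof.
have ext0E : ext0 xi = join xi (fun=> 0) by apply: funext => -[ab [c []]].
elim: k => [_|k IH kT].
  (* [V] is just some unitary that fills the places of [U] not yet chosen. *)
  have [V [uV _]] := @red_eq_unitary _ A B (prod Cc bool) (ext0 xi) (ext0 xi) erefl.
  exists (fun=> V), (ext0 xi), (join xi v), (fun _ _ => 0); split=> //.
  - split; last by apply: funext => a; apply: funext => a'; rewrite /opadd addr0.
    move=> w; rewrite /inner big1 // => i _.
    by rewrite /ap big1 ?mulr0 // => j _; rewrite mul0r.
  - rewrite red_join; apply: funext => a; apply: funext => a'.
    by rewrite /opadd mul0r addr0.
  - rewrite ext0E vsub_join vnorm2_join.
    have -> : vnorm2 (vsub xi xi) = 0.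
      by rewrite /vnorm2 big1 // => i _; rewrite /vsub subrr /= expr0n addr0.
    rewrite add0r /vnorm2; apply: ler_sum => i _; rewrite /vsub sub0r.
    by case: (v i) => a b /=; rewrite !sqrrN.
have [U [x [e [Y [uU nU [Yp redU] rede dist]]]]] := IH (ltnW kT).
have [Uk [x' [e' [Y' [uUk nUk [Y'p redUk] rede' dist']]]]] :=
  simulation_step kT Yp redU rede dist.
pose U' j := if j == k then Uk else U j.
have eU j : (j < k)%N -> Phi L U' (ext0 xi) j = Phi L U (ext0 xi) j.
  move=> jk; apply: Phi_ext => l lj.
  by rewrite /U' ltn_eqF // (leq_ltn_trans lj).
have bU : before U' k = before U k.
  by case: (k) eU => //= j eU; rewrite eU.
have PU : Phi L U' (ext0 xi) k = apU Uk (before U k) by rewrite PhiE bU /U' eqxx.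
exists U', x', e', Y'; split=> //.
- by move=> j; rewrite /U'; case: eqP.
- move=> j; rewrite ltnS leq_eqVlt => /orP[/eqP ->|jk]; first by rewrite PU.
  by rewrite eU // nU.
- by rewrite /= PU.
Qed.

Lemma simulation : exists U, [/\ forall j, unitary (U j),
  \sum_(j < T) nonidle idle (Phi L U (ext0 xi) j) <= T%:R * vnorm2 v &
  vnorm2 (vsub (part false (Phi L U (ext0 xi) T)) tau) <= vnorm2 v].
Proof.
have [U [x [e [Y [uU nU [Yp redU] rede dist]]]]] := simulation_prefix (leqnn T).
(* At [k = T] the density of [e] is that of [tau ⊗ |0> + v ⊗ |1>]. *)
have [V [uV Ve]] : exists V, unitary V /\ apU V e = join tau v.
  apply: red_eq_unitary; rewrite rede red_join; congr opadd.
  by apply: funext => a; apply: funext => a'; rewrite gainE; ring.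
set x' := apU V x.
have distV : vnorm2 (vsub (part false x') tau) <= vnorm2 v.
  apply: le_trans dist; rewrite -(vnorm2_unitary _ uV) apU_sub Ve -/x'.
  rewrite -(join_part x') vsub_join vnorm2_join lerDl; exact: vnorm2_ge0.
(* [Delta] absorbs the flag-1 part of [x'] and the deficit [Y]; only its density on [A] matters. *)
have [d dd] : exists d : vec R (prod A (prod B Cc)),
    dens d = opadd (red (part true x')) Y.
  apply: purify; first by apply: psdD => //; exact: red_psd.
  rewrite card_prod; apply: leq_trans (leq_pmull _ card_idle).
  by apply: leq_trans card_le; rewrite leq_pmulr // card_idle.
pose Delta : state := fun i => d (i.1.1, (i.1.2, i.2)).
have redD : red Delta = dens d.
  apply: funext => a; apply: funext => a'; rewrite /red /ptrB /dens pair_big /=.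
  by apply: eq_bigr => -[].
have [UT [uUT UTE]] : exists UT, unitary UT /\
    apU UT (before U T) = join (part false x') Delta.
  apply: red_eq_unitary; rewrite redU -(red_unitary x uV) -/x' -{1}(join_part x').
  rewrite !red_join redD dd; apply: funext => a; apply: funext => a'.
  by rewrite /opadd addrA.
pose U' j := if j == T then UT else U j.
have eU j : (j < T)%N -> Phi L U' (ext0 xi) j = Phi L U (ext0 xi) j.
  move=> jT; apply: Phi_ext => l lj.
  by rewrite /U' ltn_eqF // (leq_ltn_trans lj).
have PU : Phi L U' (ext0 xi) T = join (part false x') Delta.
  rewrite PhiE -UTE {1}/U' eqxx; congr apU.
  by case: (T) eU => //= j eU; rewrite eU.
exists U'; split.
- by move=> j; rewrite /U'; case: eqP.
- rewrite mulr_natl -[T in leRHS]card_ord -sumr_const; apply: ler_sum => j _.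
  by rewrite eU // nU.
- by rewrite PU.
Qed.

End Simulation.

(** * Existence of a vector of minimal norm by compactness *)

Section Attainment.
Local Open Scope classical_set_scope.
Variable R : realType.
Local Notation C := (R[i]).

Definition ccontinuous (T : topologicalType) (f : T -> C) :=
  continuous (fun x => complex.Re (f x)) /\ continuous (fun x => complex.Im (f x)).

Section CContinuous.
Variable T : topologicalType.
Implicit Types f g : T -> C.

Lemma ccontinuous_cst (z : C) : ccontinuous (fun _ : T => z).
Proof. by split; exact: cst_continuous. Qed.

Lemma ccontinuousD f g : ccontinuous f -> ccontinuous g ->
  ccontinuous (fun x => f x + g x).
Proof.
move=> [fr fi] [gr gi]; split.
  have -> : (fun x => complex.Re (f x + g x)) =
      fun x => complex.Re (f x) + complex.Re (g x).
    by apply: funext => x; rewrite raddfD.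
  by move=> x; apply: cvgD; [exact: fr | exact: gr].
have -> : (fun x => complex.Im (f x + g x)) =
    fun x => complex.Im (f x) + complex.Im (g x).
  by apply: funext => x; rewrite raddfD.
by move=> x; apply: cvgD; [exact: fi | exact: gi].
Qed.

Lemma ccontinuousM f g : ccontinuous f -> ccontinuous g ->
  ccontinuous (fun x => f x * g x).
Proof.
move=> [fr fi] [gr gi]; split.
  have -> : (fun x => complex.Re (f x * g x)) = fun x =>
      complex.Re (f x) * complex.Re (g x) - complex.Im (f x) * complex.Im (g x).
    by apply: funext => x; case: (f x) (g x) => ? ? [].
  move=> x; apply: cvgB; apply: cvgM;
    by [exact: fr | exact: gr | exact: fi | exact: gi].
have -> : (fun x => complex.Im (f x * g x)) = fun x =>
    complex.Re (f x) * complex.Im (g x) + complex.Im (f x) * complex.Re (g x).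
  by apply: funext => x; case: (f x) (g x) => ? ? [].
by move=> x; apply: cvgD; apply: cvgM;
  [exact: fr | exact: gi | exact: fi | exact: gr].
Qed.

Lemma ccontinuousJ f : ccontinuous f -> ccontinuous (fun x => conjc (f x)).
Proof.
move=> [fr fi]; split.
  have -> // : (fun x => complex.Re (conjc (f x))) = fun x => complex.Re (f x).
  by apply: funext => x; case: (f x).
have -> : (fun x => complex.Im (conjc (f x))) = fun x => - complex.Im (f x).
  by apply: funext => x; case: (f x).
by move=> x; apply: cvgN; exact: fi.
Qed.

Lemma ccontinuous_sum (I : finType) (F : I -> T -> C) :
  (forall i, ccontinuous (F i)) -> ccontinuous (fun x => \sum_i F i x).
Proof.
move=> hF; elim: (index_enum I) => [|i s IH].
  have -> : (fun x => \sum_(i <- [::]) F i x) = fun=> 0.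
    by apply: funext => x; rewrite big_nil.
  exact: ccontinuous_cst.
have -> : (fun x => \sum_(j <- i :: s) F j x) =
    fun x => F i x + \sum_(j <- s) F j x.
  by apply: funext => x; rewrite big_cons.
exact: ccontinuousD.
Qed.

Lemma closed_ceq f z : ccontinuous f -> closed [set x | f x = z].
Proof.
move=> [fr fi].
have -> : [set x | f x = z] = (fun x => complex.Re (f x)) @^-1` [set r | r = complex.Re z]
    `&` (fun x => complex.Im (f x)) @^-1` [set r | r = complex.Im z].
  apply/seteqP; split=> x /= => [-> //|[]].
  by case: (f x) z => ? ? [? ?] /= -> ->.
by apply: closedI; apply: closed_comp => [x _|]; do ?[exact: fr | exact: fi |
  exact: closed_eq].
Qed.

End CContinuous.

(** Closedness is tested along continuous maps from row vectors, which avoids a topology on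
    [vec R I]. In real coordinates, the part of [F] with norm at most that of [w0] is compact. *)
Lemma closed_min_norm (I : finType) (F : set (vec R I)) :
  (forall n (d : 'rV[R]_n -> vec R I), (forall i, ccontinuous (d^~ i)) ->
    closed (d @^-1` F)) ->
  F !=set0 -> exists2 w, F w & forall u, F u -> vnorm2 w <= vnorm2 u.
Proof.
move=> clF [w0 Fw0].
pose n := #|{: I * bool}|.
pose d (x : 'rV[R]_n) : vec R I :=
  fun i => (x 0 (enum_rank (i, false)) +i* x 0 (enum_rank (i, true)))%C.
have dsurj w : exists x, d x = w.
  exists (\row_j let p := enum_val j in
    if p.2 then complex.Im (w p.1) else complex.Re (w p.1)).
  by apply: funext => i; rewrite /d !mxE !enum_rankK /=; case: (w i).
have dcont i : ccontinuous (d^~ i).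
  by split=> /=; exact: coord_continuous.
have ncont : continuous (fun x => vnorm2 (d x)).
  have -> : (fun x => vnorm2 (d x)) = fun x => complex.Re (inner (d x) (d x)).
    by apply: funext => x; rewrite inner_vnorm2.
  suff [] : ccontinuous (fun x => inner (d x) (d x)) by [].
  by apply: ccontinuous_sum => i; apply: ccontinuousM => //; exact: ccontinuousJ.
pose r := vnorm2 w0; pose K := (d @^-1` F) `&` [set x | vnorm2 (d x) <= r].
have cK : compact K.
  (* The bound [r + 1] avoids a square root: [t^2 <= r] implies [|t| <= r + 1]. *)
  have box : compact [set x : 'rV[R]_n | forall j, `[- (r + 1), r + 1] (x ord0 j)].
    by apply: (@rV_compact _ _ (fun=> `[- (r + 1), r + 1])) => j; exact: segment_compact.
  apply: subclosed_compact box _.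
    apply: closedI; first exact: clF.
    by apply: (@closed_comp _ _ _ [set y | y <= r]) => [x _|];
      [exact: ncont | exact: closed_le].
  move=> x [_ /= xr] j; rewrite in_itv /=.
  have xj : x ord0 j ^+ 2 <= r.
    apply: le_trans xr; rewrite /vnorm2 (bigD1 (enum_val j).1) //=.
    apply: ler_wpDr; first by apply: sumr_ge0 => i _; rewrite addr_ge0 ?sqr_ge0.
    have -> : j = enum_rank ((enum_val j).1, (enum_val j).2).
      by rewrite -surjective_pairing enum_valK.
    rewrite !enum_rankK /=; case: (enum_val j).2.
      by rewrite lerDr sqr_ge0.
    by rewrite lerDl sqr_ge0.
  by apply/andP; split; nra.
have [x0 dx0] := dsurj w0.
have [|||x xK xmin] := @compact_EVT_min _ R (fun x => vnorm2 (d x)) K.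
- by exists x0; split=> /=; rewrite dx0.
- by [].
- exact: continuous_subspaceT.
move: xK; rewrite inE => -[Fx xr]; exists (d x) => // u Fu.
have [y dy] := dsurj u; rewrite -dy.
have [yr|/ltW ry] := lerP (vnorm2 (d y)) r; last exact: le_trans ry.
by apply: xmin; rewrite inE; split=> //=; rewrite dy.
Qed.

End Attainment.

(** * Optimal and feasible solutions of the adversary bound *)

Section Adversary.
Variables (R : realType) (A B Cc : finType).
Variable L : op R (prod A B).
Variables xi tau : vec R (prod (prod A B) Cc).
Local Notation C := (R[i]).
Local Notation state := (vec R (prod (prod A B) Cc)).

Lemma trace_dens (G : finType) (w : vec R (prod (prod A B) G)) :
  complex.Re (trace (dens w)) = vnorm2 w.
Proof. by rewrite -trace_ptrB -/(red w) -sum_red. Qed.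

(** Since [dens w] is always positive semidefinite, only finitely many equations remain, polynomial
    in the entries of [w] and their conjugates. *)
Lemma closed_feasible n (d : 'rV[R]_n -> state) :
  (forall i, ccontinuous (d^~ i)) ->
  closed (d @^-1` [set w | adv_feasible L xi tau (dens w)])%classic.
Proof.
move=> cd.
have cdens i j : ccontinuous (fun x : 'rV[R]_n => dens (d x) i j).
  by apply: ccontinuous_sum => g; apply: ccontinuousM => //; apply: ccontinuousJ.
pose f p (x : 'rV[R]_n) :=
  ptrB (conj_op L (dens (d x))) p.1 p.2 + (-1) * ptrB (dens (d x)) p.1 p.2.
have cf p : ccontinuous (f p).
  apply: ccontinuousD; last first.
    apply: ccontinuousM; first exact: ccontinuous_cst.
    by apply: ccontinuous_sum => b; exact: cdens.
  apply: ccontinuous_sum => b; apply: ccontinuous_sum => k.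
  apply: ccontinuous_sum => l.
  by do !apply: ccontinuousM => //; exact: ccontinuous_cst.
have -> : (d @^-1` [set w | adv_feasible L xi tau (dens w)] =
  \bigcap_(p in [set: A * A]) [set x | f p x =
    ptrBC_outer tau tau p.1 p.2 - ptrBC_outer xi xi p.1 p.2])%classic.
  apply/seteqP; split=> x /= => [[_ h] p _|h] /=; first by rewrite /f mulN1r h.
  split=> [|a a']; first exact: dens_psd.
  by rewrite -(h (a, a')) // /f mulN1r.
by apply: closed_bigI => p _; exact: closed_ceq.
Qed.

Hypothesis card_le : (#|A| * #|B| <= #|Cc|)%N.

(** Passing to purifications [w] makes positivity automatic and turns the trace into [vnorm2 w]; by
    [card_le] every feasible [pi] has one. *)
Lemma Adv_attained : (Adv L xi tau < +oo)%E ->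
  exists w : state, adv_feasible L xi tau (dens w) /\
    Adv L xi tau = (vnorm2 w / vnorm2 xi)%:E.
Proof.
move=> Adv_fin.
have pure pi : adv_feasible L xi tau pi -> exists w : state, dens w = pi.
  by move=> [pi_psd _]; apply: purify; rewrite ?card_prod.
have [pi0 f0] : exists pi, adv_feasible L xi tau pi.
  apply: contrapT => /forallNP nf; move: Adv_fin.
  suff -> : Adv L xi tau = +oo%E by rewrite ltxx.
  by apply/ereal_inf_pinfty => y [pi /nf].
pose F := [set w : state | adv_feasible L xi tau (dens w)]%classic.
have F0 : (F !=set0)%classic.
  by have [w0 dw0] := pure _ f0; exists w0; rewrite /F /= dw0.
have [w fw wmin] := closed_min_norm (F := F) closed_feasible F0.
exists w; split=> //; apply/eqP; rewrite eq_le; apply/andP; split.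
  by apply: ereal_inf_lbound; exists (dens w) => //; rewrite trace_dens.
apply: le_ereal_inf_tmp => _ [pi fpi <-].
have [u du] := pure _ fpi; rewrite -du trace_dens lee_fin.
apply: ler_wpM2r; first by rewrite invr_ge0 vnorm2_ge0.
by apply: wmin; rewrite /F /= du.
Qed.

Lemma algorithm_feasible (T : nat) (U : nat -> op R (prod B Cc)) :
  subunitary L -> is_algorithm U T -> run L U T xi = tau ->
  exists pi, adv_feasible L xi tau pi /\
    complex.Re (trace pi) <= T%:R * vnorm2 xi.
Proof.
move=> subL algU; rewrite /run => <-.
(* The norm bound on the last state strengthens the induction: each new density then has trace at
   most [vnorm2 xi]. *)
suff [pi [pi_psd pi_red pi_tr _]] : exists pi : op R (prod A B), [/\ psd pi,
    forall a a', ptrB (conj_op L pi) a a' - ptrB pi a a'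
      = red (Phi L U xi T) a a' - red xi a a',
    complex.Re (trace pi) <= T%:R * vnorm2 xi &
    vnorm2 (Phi L U xi T) <= vnorm2 xi].
  by exists pi.
elim: T algU => [|T IH] algU.
  have uU0 := algU 0%N isT.
  exists (fun _ _ => 0); split=> /=.
  - move=> w; rewrite /inner big1 // => i _.
    by rewrite /ap big1 ?mulr0 // => j _; rewrite mul0r.
  - move=> a a'; rewrite red_unitary // subrr /ptrB !big1 ?subrr // => b _.
    rewrite /conj_op big1 // => k _; rewrite big1 // => l _.
    by rewrite mulr0 mul0r.
  - by rewrite mul0r /trace big1.
  - by rewrite vnorm2_unitary.
have [|pi [pi_psd pi_red pi_tr le_xi]] := IH.
  by move=> j jT; apply: algU; exact: leqW.
have uU := algU T.+1 (leqnn _).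
exists (opadd pi (dens (Phi L U xi T))); split=> /=.
- by apply: psdD => //; exact: dens_psd.
(* Telescoping: the new summand contributes the density on [A] after [L] minus the one before. *)
- move=> a a'; rewrite red_unitary // conj_opD !ptrBD -dens_apL /opadd.
  by rewrite opprD addrACA pi_red -/(red _) -/(red (Phi L U xi T)) addrC subrKA.
- rewrite -trace_ptrB ptrBD /opadd big_split !trace_ptrB raddfD /= trace_dens.
  by rewrite mulrSr mulrDl mul1r lerD.
- rewrite vnorm2_unitary //; exact: le_trans (vnorm2_apL _ subL) le_xi.
Qed.

(* [T = 0] makes [T^-1] the junk value 0, hence the extra hypothesis. *)
Lemma scaled_catalyst (w : state) (T : nat) :
  adv_feasible L xi tau (dens w) -> (T = 0%N -> vnorm2 w = 0) ->
  exists v : state, vnorm2 v = T%:R^-1 * vnorm2 w /\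
    forall a a', T%:R * gain L v a a' = red tau a a' - red xi a a'.
Proof.
move=> [_ fw] T0; pose s : R := Num.sqrt (T%:R^-1).
have ss : s ^+ 2 = T%:R^-1 by rewrite sqr_sqrtr ?invr_ge0.
exists (fun i => w i * s%:C%C); split.
  rewrite /vnorm2 mulr_sumr; apply: eq_bigr => i _; rewrite -ss.
  by case: (w i) => a b /=; ring.
move=> a a'; rewrite /gain /red dens_apL.
set M := dens _.
have -> : M = fun i j => (T%:R^-1)%:C%C * dens w i j.
  apply: funext => i; apply: funext => j; rewrite /M /dens mulr_sumr.
  apply: eq_bigr => g _; rewrite -ss rmorphXn.
  have -> : conjc (w (j, g) * s%:C%C) = conjc (w (j, g)) * s%:C%C.
    by rewrite -[X in _ = _ * X]conjc_real; exact: rmorphM.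
  by rewrite /=; ring.
have -> : ptrB (conj_op L (fun i j => (T%:R^-1)%:C%C * dens w i j)) a a'
    = (T%:R^-1)%:C%C * ptrB (conj_op L (dens w)) a a'.
  rewrite /ptrB mulr_sumr; apply: eq_bigr => b _.
  rewrite /conj_op mulr_sumr; apply: eq_bigr => k _.
  by rewrite mulr_sumr; apply: eq_bigr => l _; ring.
have -> : ptrB (fun i j => (T%:R^-1)%:C%C * dens w i j) a a'
    = (T%:R^-1)%:C%C * ptrB (dens w) a a'.
  by rewrite /ptrB mulr_sumr.
(* For [T = 0], [w = 0] and feasibility already says that the two densities agree. *)
rewrite -mulrBr fw mulrA; case: T T0 @s ss @M => [|T] T0 s ss M.
  have w0 := vnorm2_eq0 (T0 erefl).
  rewrite mul0r mul0r -[RHS]fw.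
  have -> : dens w = fun _ _ => 0.
    by apply: funext => i; apply: funext => j; rewrite /dens big1 // => g _;
      rewrite w0 mul0r.
  rewrite /ptrB !big1 ?subrr // => b _.
  rewrite /conj_op big1 // => k _; rewrite big1 // => l _.
  by rewrite mulr0 mul0r.
by rewrite fmorphV /= rmorph_nat divff ?mul1r // pnatr_eq0.
Qed.

End Adversary.

(** * The bounds for exact and for approximate algorithms *)

Theorem theorem1 (R : realType) (A B Cc : finType)
  (idle : vec R B) (L : op R (prod A B))
  (xi tau : vec R (prod (prod A B) Cc)) :
  (#|A| * #|B| <= #|Cc|)%N ->
  vnorm2 idle = 1 ->
  subunitary L ->
  (forall phi : vec R A, ap L (tens phi idle) = tens phi idle) ->
  (exists i, xi i != 0) ->
  (* (1) lower bound on exact algorithms with ancilla space Cc *)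
  (forall (T : nat) (U : nat -> op R (prod B Cc)),
      is_algorithm U T -> run L U T xi = tau ->
      (Adv L xi tau <= (T%:R)%:E)%E)
  /\
  (* (2) approximate algorithm with ancilla space Cc ⊗ C^2 *)
  ((Adv L xi tau < +oo)%E ->
   forall eps : R, 0 < eps ->
   let T' := `|Num.ceil (fine (Adv L xi tau) / eps ^+ 2)|%N in
   exists U : nat -> op R (prod B (prod Cc bool)),
     is_algorithm U T' /\
     (exists tau' Delta : vec R (prod (prod A B) Cc),
        (forall (a : A) (b : B) (c : Cc),
            run L U T' (ext0 xi) ((a, b), (c, false)) = tau' ((a, b), c) /\
            run L U T' (ext0 xi) ((a, b), (c, true)) = Delta ((a, b), c)) /\
        vnorm (vsub tau' tau) / vnorm xi <= eps) /\
     ((\sum_(j < T') nonidle idle (Phi L U (ext0 xi) j) / vnorm2 xi)%:E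
        <= Adv L xi tau)%E).
Proof.
move=> card_le idle1 subL L_idle [i0 xi0].
have xi_gt0 : 0 < vnorm2 xi.
  rewrite lt_neqAle vnorm2_ge0 andbT eq_sym; apply: contra xi0 => /eqP xi0.
  by rewrite (vnorm2_eq0 xi0).
split=> [T U algU runU|Adv_fin eps eps_gt0 T'].
  have [pi [fpi tr_pi]] := algorithm_feasible subL algU runU.
  apply: ge_ereal_inf; exists ((complex.Re (trace pi) / vnorm2 xi)%:E).
    by exists pi.
  by rewrite lee_fin ler_pdivrMr.
have [w [fw AdvE]] := Adv_attained card_le Adv_fin.
have eps2_gt0 : 0 < eps ^+ 2 by rewrite exprn_gt0.
have w_le : vnorm2 w <= T'%:R * (eps ^+ 2 * vnorm2 xi).
  rewrite mulrA -ler_pdivrMr // -ler_pdivrMr // /T' AdvE /=.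
  (* The ceiling is nonnegative, so the absolute value in [T'] does not change it. *)
  rewrite natr_absz ger0_norm; first exact: Num.Theory.ceil_ge.
  rewrite ceil_ge0; apply: lt_le_trans (ltrN10 _) _.
  by rewrite !divr_ge0 ?vnorm2_ge0 // ltW.
(* By [w_le], [T' = 0] forces [vnorm2 w = 0]. *)
have [|v [vE gainE]] := scaled_catalyst (T := T') fw.
  by move=> T0; apply/eqP; rewrite eq_le vnorm2_ge0 andbT (le_trans w_le) ?T0 ?mul0r.
have v_le : vnorm2 v <= eps ^+ 2 * vnorm2 xi.
  rewrite vE; have [->|T'0] := eqVneq T' 0%N.
    by rewrite invr0 mul0r mulr_ge0 // ltW.
  by rewrite ler_pdivrMl // ltr0n lt0n.
have [U [uU sumU distU]] := simulation idle1 subL L_idle card_le gainE.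
exists U; split; first by [].
split.
  exists (part false (Phi L U (ext0 xi) T')), (part true (Phi L U (ext0 xi) T')).
  split=> //; rewrite /vnorm ler_pdivrMr ?sqrtr_gt0 //.
  rewrite -(gtr0_norm eps_gt0) -sqrtr_sqr -sqrtrM ?sqr_ge0 //.
  by rewrite ler_wsqrtr // (le_trans distU).
rewrite AdvE lee_fin -mulr_suml ler_pM2r ?invr_gt0 //.
apply: le_trans sumU _; rewrite vE mulrA.
(* The total [T' * vnorm2 v] cancels to [vnorm2 w] when [T'] is nonzero. *)
have [->|T'0] := eqVneq T' 0%N; first by rewrite mul0r mul0r vnorm2_ge0.
by rewrite divff ?mul1r // pnatr_eq0.
Qed.
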